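(* Let $k$ be a field, $S=k[x_1,\ldots,x_n]$, $\mathfrak m=(x_1,\ldots,x_n)$, and $d\ge2$ an integer. Let $u=x_1^{a_1}\cdots x_n^{a_n}$ and $v=x_q^{b_q}\cdots x_n^{b_n}$, $1\le q\le n$, $a_1,b_q>0$, be two monomials of degree $d$ such that $u\ge_{lex}v$, and let $I$ be the lexsegment ideal generated by $\mathcal L(u,v)$. Assume that $I\ne\mathfrak m^d$. Then $$\dim(S/I)=\begin{cases}n-q, & \text{if } 1\le q<n,\\ 1, & \text{if } q=n.\end{cases}$$
   Context: Lexicographic order is taken with $x_1>\cdots>x_n$. $\mathcal L(u,v)$ is the set of all monomials $w$ of degree $d$ of $S$ with $u\ge_{lex}w\ge_{lex}v$. $\dim$ denotes Krull dimension. *)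

(* Defs.v *)
From HB Require Import structures.
From mathcomp Require Import all_boot all_order all_algebra.
From mathcomp Require Import ring_quotient mpoly.
From mathcomp Require Import boolp.

Set Implicit Arguments.
Unset Strict Implicit.
Unset Printing Implicit Defensive.

Import Order.TTheory GRing.Theory.
Local Open Scope ring_scope.

Section Ideals.
Variable R : comNzRingType.

(* Ideals are the boolean predicates of ring_quotient; [asbool] turns the
   (undecidable in general) membership condition into such a predicate. *)
Definition ideal_gen (G : R -> Prop) : {pred R} := fun p =>
  `[< exists s : seq (R * R),
        (forall x, x \in s -> G x.2) /\ p = \sum_(x <- s) x.1 * x.2 >].

Definition ideal_pow (J : {pred R}) (d : nat) : {pred R} :=
  ideal_gen (fun p => exists2 s : d.-tuple R,
    {subset s <= J} & p = \prod_(x <- s) x).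

(* [l] counts the strict inclusions; the values P i for l < i are irrelevant. *)
Definition prime_chain (l : nat) (P : nat -> prime_idealr R) : Prop :=
  forall i, (i < l)%N ->
    {subset P i <= P i.+1} /\ ~ {subset P i.+1 <= P i}.

(* The supremum of the lengths of chains of primes of R exists, is attained
   and equals m (so an infinite-dimensional ring satisfies this for no m). *)
Definition has_krull_dim (m : nat) : Prop :=
  (exists P, prime_chain m P) /\
  (forall l P, prime_chain l P -> (l <= m)%N).

End Ideals.

Section Lexsegment.
Variables (n : nat) (k : fieldType).

(* Pure lexicographic comparison of exponent vectors, hence x_1 > ... > x_n;
   the canonical order on 'X_{1..n} compares total degrees first. *)
Definition lex_le (m1 m2 : 'X_{1..n}) : bool :=
  ((m1 : seqlexi nat) <= (m2 : seqlexi nat))%O.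

Definition lexseg (d : nat) (u v : 'X_{1..n}) : {pred 'X_{1..n}} :=
  [pred w | [&& mdeg w == d, lex_le v w & lex_le w u]].

Definition lexseg_ideal (d : nat) (u v : 'X_{1..n}) : {pred {mpoly k[n]}} :=
  ideal_gen (fun p => exists2 w, w \in lexseg d u v & p = 'X_[w]).

Definition max_ideal : {pred {mpoly k[n]}} :=
  ideal_gen (fun p => exists i : 'I_n, p = 'X_i).

Lemma lexseg_ideal_closed (d : nat) (u v : 'X_{1..n}) :
  (0 < d)%N -> idealr_closed (lexseg_ideal d u v).
Proof.
move=> d_gt0; split.
- by apply/asboolP; exists [::]; split=> //; rewrite big_nil.
- apply/negP => /asboolP[s [sG]] /(congr1 (mcoeff 0%MM)).
  rewrite mcoeff1 eqxx raddf_sum big_seq big1 => [/eqP|x xs /=].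
    by rewrite oner_eq0.
  have [w] := sG x xs; rewrite inE => /andP[/eqP wd _] ->.
  rewrite rmorphM/= mcoeffX -mdeg_eq0 wd eqn0Ngt d_gt0 mulr0 //.
- move=> a p r /asboolP[s [sG ->]] /asboolP[t [tG ->]]; apply/asboolP.
  exists ([seq (a * x.1, x.2) | x <- s] ++ t); split.
    move=> x; rewrite mem_cat => /orP[/mapP[y ys ->]|]; last exact: tG.
    exact: sG ys.
  rewrite big_cat big_map mulr_sumr /=; congr (_ + _).
  by apply: eq_bigr => x _; rewrite mulrA.
Qed.

Section Packed.
Variables (d : nat) (u v : 'X_{1..n}) (d_gt0 : (0 < d)%N).

(* The same ideal as a library [idealr], which requires properness and thus
   d > 0; this gives access to the quotient ring {ideal_quot _}. *)
Definition lexseg_idealr : idealr {mpoly k[n]} :=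
  HB.pack (lexseg_ideal d u v)
    (isIdealr.Build _ _ (lexseg_ideal_closed u v d_gt0)).
End Packed.

End Lexsegment.

Arguments max_ideal n k : clear implicits.
Arguments lexseg_ideal {n} k d u v.
Arguments lexseg_idealr {n} k {d} u v d_gt0.

(* Main.v *)
(** Since [I] is a monomial ideal, the dimension of [S/I] is [n] minus the least
    size of a set of variables meeting the support of every generator: setting
    such a set of variables to zero, then one more variable at a time, gives a
    chain of primes, and conversely every prime containing [I] contains such a
    set.  The upper bound on the length of a chain [P_0 < ... < P_l] of primes,
    [P_0] containing the variables in [Z], is the argument of Coquand and
    Lombardi: if [l > n - #|Z|], elements [y_i] of [P_(i+1)] outside [P_i] satisfy
    a nontrivial polynomial relation modulo [P_0], and its lexicographically
    lowest term forces [1 \in P_l].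

    If [q < n], every such set contains [x_2, ..., x_q], because of their [d]-th
    powers, and one more variable, because of [x_1 x_n^(d-1)] (of [u] if [q = 1]);
    [{x_1, ..., x_q}] is one of them.  If [q = n], then [I <> m^d] means
    [u <> x_1^d], and [{x_2, ..., x_n}] is the least one. *)

Require Import Defs.
From HB Require Import structures.
From mathcomp Require Import all_boot all_order all_algebra.
From mathcomp Require Import ring_quotient mpoly.
From mathcomp Require Import boolp zify ring.

Set Implicit Arguments.
Unset Strict Implicit.
Unset Printing Implicit Defensive.

Import Order.TTheory GRing.Theory.
Local Open Scope ring_scope.

(** * Length of chains of primes *)

Lemma prime_idealrX (R : comNzRingType) (P : prime_idealr R) (x : R) e :
  x ^+ e \in P -> x \in P.
Proof.
elim: e => [|e IHe]; first by rewrite expr0 idealr1.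
by rewrite exprS prime_idealrM => /orP[].
Qed.

Lemma prime_idealr_prod (R : comNzRingType) (P : prime_idealr R) (I : Type)
    (s : seq I) (F : I -> R) :
  \prod_(i <- s) F i \in P -> exists i, F i \in P.
Proof.
elim: s => [|i s IHs]; first by rewrite big_nil idealr1.
by rewrite big_cons prime_idealrM => /orP[Pi|/IHs//]; exists i.
Qed.

(* The lexicographically lowest terms of the relation are peeled off one
   variable at a time: modulo [P j], factor out the lowest power of [y j], which
   is not in [P j], then kill the remaining multiples of [y j] in [P j.+1]. *)
Lemma prime_chain_independent (k : fieldType) (R : comNzRingType)
    (iota : {rmorphism k -> R}) l (P : nat -> prime_idealr R) (y : 'I_l -> R) N
    (c : {ffun 'I_l -> 'I_N} -> k) :
  prime_chain l P -> (forall i : 'I_l, y i \in P i.+1 /\ y i \notin P i) ->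
  \sum_a iota (c a) * \prod_i y i ^+ a i \in P 0%N -> forall a, c a = 0.
Proof.
move=> chP yP rel0 a1; apply/eqP/negP => /negP ca1.
have peel j : (j <= l)%N -> exists2 E : {set {ffun 'I_l -> 'I_N}}, E != set0 &
    [/\ {in E, forall a, c a != 0},
        {in E &, forall a b : {ffun 'I_l -> 'I_N},
           forall i : 'I_l, (i < j)%N -> a i = b i} &
        \sum_(a in E) iota (c a) * \prod_(i < l | (j <= i)%N) y i ^+ a i \in P j].
  elim: j => [_|j IHj ltjl].
    exists [set a | c a != 0]; first by apply/set0Pn; exists a1; rewrite inE.
    split=> [a|//|]; first by rewrite inE.
    rewrite (eq_bigl (fun a => c a != 0)) => [|a]; last by rewrite inE.
    rewrite big_mkcond/= (eq_bigr (fun a => iota (c a) * \prod_i y i ^+ a i)) //.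
    by move=> a _; case: eqVneq => [->|//]; rewrite rmorph0 mul0r.
  have [E /set0Pn[b0 Eb0] [cE eqE sumE]] := IHj (ltnW ltjl).
  pose o := Ordinal ltjl.
  have [a0 inEa0 min_a0] :=
    arg_minnP (fun a : {ffun 'I_l -> 'I_N} => a o : nat) Eb0.
  have Ea0 : a0 \in E := inEa0.
  have [yP1 yP0] := yP o.
  pose E' := [set a in E | a o == a0 o]; exists E'.
    by apply/set0Pn; exists a0; rewrite inE Ea0 eqxx.
  split=> [a /setIdP[Ea _]|a b /setIdP[Ea /eqP ao] /setIdP[Eb /eqP bo] i|].
  - exact: cE.
  - rewrite ltnS leq_eqVlt => /orP[/eqP ij|]; last exact: eqE.
    by have -> : i = o by [apply: val_inj]; rewrite ao bo.
  pose tl (a : {ffun 'I_l -> 'I_N}) := \prod_(i < l | (j < i)%N) y i ^+ a i.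
  pose G := \sum_(a in E | a o != a0 o) iota (c a) * (y o ^+ (a o - a0 o).-1 * tl a).
  have splitE : \sum_(a in E) iota (c a) * \prod_(i < l | (j <= i)%N) y i ^+ a i
      = y o ^+ a0 o * (\sum_(a in E') iota (c a) * tl a + y o * G).
    rewrite mulrDr !mulr_sumr (bigID (fun a : {ffun 'I_l -> 'I_N} => a o == a0 o))/=.
    have tlE (a : {ffun 'I_l -> 'I_N}) : 
        \prod_(i < l | (j <= i)%N) y i ^+ a i = y o ^+ a o * tl a.
      rewrite (bigD1 o)//=; congr (_ * _); apply: eq_bigl => i.
      by rewrite ltn_neqAle andbC eq_sym.
    congr (_ + _).
      by apply: eq_big => [a|a /andP[_ /eqP ao]];
        rewrite ?inE // tlE ao mulrCA.
    apply: eq_bigr => a /andP[Ea ao].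
    have lt_a0a : (a0 o < a o)%N by rewrite ltn_neqAle eq_sym ao min_a0.
    have ao_split : (a o = a0 o + (a o - a0 o).-1.+1 :> nat)%N by lia.
    by rewrite tlE [X in y o ^+ X * tl a]ao_split exprD exprS; ring.
  have : \sum_(a in E') iota (c a) * tl a + y o * G \in P j.+1.
    apply: (chP j ltjl).1; move: sumE; rewrite splitE prime_idealrM.
    by case/orP => // /prime_idealrX yoP; rewrite yoP in yP0.
  by rewrite rpredDr // mulrC idealMr.
(* Once all exponents are fixed, a single nonzero constant remains in [P l]; it is a unit, against
   properness. *)
have [E /set0Pn[a Ea] [cE eqE]] := peel l (leqnn l).
have -> : E = [set a].
  apply/setP => b; rewrite inE; apply/idP/eqP => [Eb|->//].
  by apply/ffunP => i; apply: eqE.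
rewrite big_set1 big_pred0 => [|i]; last by rewrite leqNgt ltn_ord.
rewrite mulr1 => /(idealMr (iota (c a)^-1)).
by rewrite -rmorphM mulVf ?cE // rmorph1 idealr1.
Qed.

(** * Algebraic relations by counting monomials *)

Section MonomialCount.
Variables (k : fieldType) (n : nat).

Lemma msizeM_leq (p r : {mpoly k[n]}) a b :
  (msize p <= a.+1 -> msize r <= b.+1 -> msize (p * r) <= (a + b).+1)%N.
Proof.
have [->|p0] := eqVneq p 0; first by rewrite mul0r msize0.
have [->|r0] := eqVneq r 0; first by rewrite mulr0 msize0.
by rewrite msizeM //; move: (msize p) (msize r) => s t; lia.
Qed.

Lemma msizeX_leq (p : {mpoly k[n]}) a e :
  (msize p <= a.+1 -> msize (p ^+ e) <= (e * a).+1)%N.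
Proof.
move=> pa; elim: e => [|e IHe]; first by rewrite expr0 msize1.
by rewrite exprS mulSn; apply: msizeM_leq.
Qed.

Lemma msize_prod_leq (I : finType) (F : I -> {mpoly k[n]}) a :
  (forall i, msize (F i) <= a.+1)%N -> (msize (\prod_i F i) <= (#|I| * a).+1)%N.
Proof.
move=> Fa; rewrite -sum1_card.
elim/big_rec2: _ => [|i s p _ IHp]; first by rewrite msize1.
by rewrite mulnDl mul1n; apply: msizeM_leq.
Qed.

(** The left side grows like [N^r] only. With [K = l * D + 1] it is at most [N^r * K^r], so any
    [N > K^r] works. *)
Lemma ltn_exp_affine (l r D : nat) : (r < l)%N ->
  exists2 N, (0 < N)%N & ((l * (N * D)).+1 ^ r < N ^ l)%N.
Proof.
move=> ltrl; pose K := (l * D).+1; exists (K ^ r).+1 => //; set N := (K ^ r).+1.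
have leB : ((l * (N * D)).+1 <= N * K)%N by rewrite /K mulnS mulnCA -add1n leq_add2r.
apply: (@leq_ltn_trans ((N * K) ^ r)); first by case: (r) => // r'; rewrite leq_exp2r.
rewrite expnMn (@leq_trans (N ^ r * N)) ?ltn_pmul2l ?expn_gt0 //.
by rewrite -expnSr leq_pexp2l.
Qed.

(* There are [N ^ l] products of powers, but the monomials free of [Z] that occur
   in them number only [O(N ^ (n - #|Z|))]. *)
Lemma mpoly_relation (Z : {set 'I_n}) l (y : 'I_l -> {mpoly k[n]}) :
  (n - #|Z| < l)%N ->
  exists N (c : {ffun 'I_l -> 'I_N} -> k), (exists a, c a != 0) /\
    forall m : 'X_{1..n}, {in Z, forall j, m j = 0%N} ->
      (\sum_a (c a)%:MP * \prod_i y i ^+ a i)@_m = 0.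
Proof.
move=> ltl; pose D := \max_i msize (y i).
have [N N0 ltN] := ltn_exp_affine D ltl.
pose B := (l * (N * D)).+1.
pose T : finType := {ffun 'I_l -> 'I_N}.
pose V : finType := {j : 'I_n | j \notin Z}.
pose U : finType := {ffun V -> 'I_B}.
pose F (a : T) := \prod_i y i ^+ a i.
pose mon (b : U) : 'X_{1..n} :=
  [multinom (if insub j is Some s then b s : nat else 0%N) | j < n].
have cardV : #|V| = (n - #|Z|)%N.
  rewrite card_sig; have := cardsC Z; rewrite card_ord => /(canRL (addKn _)) <-.
  by apply: eq_card => j; rewrite !inE.
(* Rows are the products [F a], columns the monomials free of [Z] with exponents below [B]. There
   are more rows than columns, so a left kernel vector supplies [c]. *)
pose M : 'M[k]_(#|T|, #|U|) :=
  \matrix_(a, b) (F (enum_val a))@_(mon (enum_val b)).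
have : kermx M != 0.
  rewrite -mxrank_eq0 mxrank_ker subn_eq0 -ltnNge.
  by rewrite (leq_ltn_trans (rank_leq_col M)) // !card_ffun !card_ord cardV.
case/rowV0Pn => w /sub_kermxP wM /rV0Pn[a0 wa0].
exists N, (fun a => w 0 (enum_rank a)); split.
  by exists (enum_val a0); rewrite enum_valK.
move=> m mZ; rewrite raddf_sum/=.
have Fsize a : (msize (F a) <= B)%N.
  suff /msize_prod_leq : forall i, (msize (y i ^+ a i) <= (N * D).+1)%N.
    by rewrite card_ord.
  move=> i; apply: (@leq_trans (a i * D).+1).
    by apply: msizeX_leq; apply/leqW; exact: (leq_bigmax i).
  by rewrite ltnS leq_mul2r ltnW ?orbT.
have [ltmB|leBm] := ltnP (mdeg m) B; last first.
  rewrite big1 // => a _; rewrite mcoeffCM memN_msupp_eq0 ?mulr0 //.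
  by apply: msize_mdeg_ge; apply: leq_trans (Fsize a) leBm.
have ltm (s : V) : (m (val s) < B)%N.
  by apply: leq_ltn_trans ltmB; rewrite mdegE (bigD1 (val s))//= leq_addr.
pose b : U := [ffun s => Ordinal (ltm s)].
have mE : m = mon b.
  apply/mnmP => j; rewrite mnmE; case: insubP => [s _ <-|].
    by rewrite ffunE.
  by rewrite negbK => /mZ.
have /rowP/(_ (enum_rank b)) := wM; rewrite !mxE => wM0.
rewrite -[RHS]wM0 [RHS](reindex (@enum_rank T)) /=; last exact/onW_bij/enum_rank_bij.
by apply: eq_bigr => a _; rewrite mcoeffCM mxE !enum_rankK -mE.
Qed.

End MonomialCount.

(** In the relation between lifts of the [y i], only monomials meeting [Z] survive, and [g] sends
    these into [P 0]; independence along the chain then makes all coefficients vanish, a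
    contradiction. *)
Lemma prime_chain_leq (k : fieldType) n (R : comNzRingType)
    (g : {rmorphism {mpoly k[n]} -> R}) (Z : {set 'I_n}) l
    (P : nat -> prime_idealr R) :
  (forall x, exists p, g p = x) -> {in Z, forall j, g 'X_j \in P 0%N} ->
  prime_chain l P -> (l <= n - #|Z|)%N.
Proof.
move=> gsurj gZ chP; rewrite leqNgt; apply/negP => ltl.
have /choice[y yP] (i : 'I_l) :
    exists p, g p \in P i.+1 /\ g p \notin P i.
  apply: contrapT => noy; case: (chP i (ltn_ord i)) => _; apply => x.
  have [p <-] := gsurj x => Pp; apply: contrapT => /negP nPp.
  by apply: noy; exists p.
have [N [c [[a ca] rel]]] := mpoly_relation y ltl.
move/eqP: ca; apply; apply: (@prime_chain_independent k R (g \o @mpolyC n k)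
  l P (g \o y) N c chP yP) => /=.
set r := \sum_a _ in rel.
have <- : g r = \sum_a g (c a)%:MP * \prod_i g (y i) ^+ a i.
  rewrite rmorph_sum; apply: eq_bigr => b _; rewrite rmorphM rmorph_prod.
  by congr (_ * _); apply: eq_bigr => i _; rewrite rmorphXn.
rewrite (mpolyE r) rmorph_sum rpred_sum // => m _.
have [/existsP[j /andP[Zj mj]]|nom] := boolP [exists j in Z, m j != 0%N].
  have -> : m = (m - U_(j) + U_(j))%MM by rewrite submK // lep1mP.
  by rewrite -mul_mpolyC mpolyXD mulrA rmorphM idealMr // gZ.
rewrite rel ?scale0r ?rmorph0 ?idealr0 // => j Zj.
by apply: contraNeq nom => mj; apply/existsP; exists j; rewrite Zj.
Qed.

(** * Chains of primes of a monomial quotient *)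

Section KernelPrimes.
Variables (R : comNzRingType) (I : idealr R) (D : idomainType).
Variables (f : {rmorphism R -> D}).
Hypothesis fI : {in I, forall x, f x = 0}.

Local Open Scope quotient_scope.

(** The kernel of the map induced by [f] on the quotient by [I]: [fI] makes it independent of
    representatives, and it is prime because [D] is a domain. *)
Definition quot_kernel : {pred {ideal_quot I}} := fun x => f (repr x) == 0.

Lemma mem_quot_kernel p : (\pi_({ideal_quot I}) p \in quot_kernel) = (f p == 0).
Proof.
rewrite unfold_in; set r := repr _; have : f (p - r) = 0.
  by apply: fI; rewrite Quotient.idealrBE reprK.
by rewrite rmorphB => /subr0_eq ->.
Qed.

Lemma quot_kernel_idealr : idealr_closed quot_kernel.
Proof.
split=> [||a x y].
- by rewrite -(rmorph0 \pi_({ideal_quot I})) mem_quot_kernel rmorph0.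
- by rewrite -(rmorph1 \pi_({ideal_quot I})) mem_quot_kernel rmorph1 oner_eq0.
- rewrite -[a]reprK -[x]reprK -[y]reprK -rmorphM -rmorphD !mem_quot_kernel.
  by move=> /eqP fx /eqP fy; rewrite rmorphD rmorphM fx fy mulr0 addr0.
Qed.

Lemma quot_kernel_prime : prime_idealr_closed quot_kernel.
Proof.
move=> x y; rewrite -[x]reprK -[y]reprK -rmorphM !mem_quot_kernel.
by rewrite rmorphM mulf_eq0.
Qed.

Definition quot_kernel_prime_idealr : prime_idealr {ideal_quot I} :=
  HB.pack quot_kernel (isIdealr.Build _ _ quot_kernel_idealr)
    (isPrimeIdealrClosed.Build _ _ quot_kernel_prime).

End KernelPrimes.

Section VariableKilling.
Variables (k : fieldType) (n : nat).
Implicit Types (A : {set 'I_n}) (m : 'X_{1..n}).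

Definition touches A m := [exists j in A, (0 < m j)%N].

(** Its kernel is the prime generated by the variables in [A], presented this way as the kernel of a
    map to a domain. *)
Definition kill A : {mpoly k[n]} -> {mpoly k[n]} :=
  mmap (@mpolyC n k) (fun j => if j \in A then 0 else 'X_j).
HB.instance Definition _ A := GRing.RMorphism.on (kill A).

Lemma killX A m : kill A 'X_[m] = if touches A m then 0 else 'X_[m].
Proof.
rewrite /kill mmapX /mmap1; case: ifPn => [/existsP[j /andP[Aj mj]]|nAm].
  by rewrite (bigD1 j)//= Aj expr0n eqn0Ngt mj mul0r.
rewrite [RHS]mpolyXE_id; apply: eq_bigr => j _; case: ifPn => // Aj.
have -> : m j = 0%N; last by [].
apply/eqP; rewrite -leqn0 leqNgt; apply: contra nAm => mj.
by apply/existsP; exists j; rewrite Aj.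
Qed.

Lemma killC A c : kill A c%:MP = c%:MP.
Proof. exact: mmapC. Qed.

Lemma killE A p : kill A p = \sum_(m <- msupp p) (p@_m)%:MP * kill A 'X_[m].
Proof.
rewrite {1}(mpolyE p) (rmorph_sum (kill A)); apply: eq_bigr => m _.
by rewrite -mul_mpolyC rmorphM/= killC.
Qed.

Lemma kill_comp A A' p : A \subset A' -> kill A' (kill A p) = kill A' p.
Proof.
move=> /subsetP sAA'; rewrite (killE A) (killE A' p) (rmorph_sum (kill A')).
apply: eq_bigr => m _; rewrite rmorphM/= killC; congr (_ * _).
rewrite !killX; case: ifPn => [/existsP[j /andP[Aj mj]]|]; last by rewrite killX.
by rewrite rmorph0 ifT //; apply/existsP; exists j; rewrite sAA'.
Qed.

Lemma kill_lexseg (d : nat) (u v : 'X_{1..n}) A :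
  {in lexseg d u v, forall w, touches A w} ->
  {in lexseg_ideal k d u v, forall p, kill A p = 0}.
Proof.
move=> tA p /asboolP[s [sG ->]]; rewrite rmorph_sum big_seq big1 // => x xs.
have [w Lw xE] := sG x xs.
by rewrite rmorphM/= xE killX tA // mulr0.
Qed.

(** [P i] is the kernel of setting to zero [C] and the first [i] variables outside [C]; the next
    variable makes each inclusion strict. *)
Lemma lexseg_prime_chain (d : nat) (u v : 'X_{1..n}) (d0 : (0 < d)%N) C :
  {in lexseg d u v, forall w, touches C w} ->
  exists P : nat -> prime_idealr {ideal_quot (lexseg_idealr k u v d0)},
    prime_chain (n - #|C|) P.
Proof.
move=> tC; pose e := enum (~: C).
pose A i : {set 'I_n} := C :|: [set j in take i e].
have tA i : {in lexseg d u v, forall w, touches (A i) w}.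
  move=> w /tC/existsP[j /andP[Cj wj]].
  by apply/existsP; exists j; rewrite inE Cj.
pose I := lexseg_idealr k u v d0.
pose K i := @mem_quot_kernel _ I _ (kill (A i)) (kill_lexseg (tA i)).
exists (fun i => @quot_kernel_prime_idealr _ I _ (kill (A i)) (kill_lexseg (tA i))).
move=> i lti.
have sz_e : size e = (n - #|C|)%N by rewrite -cardE cardsCs setCK card_ord.
pose j0 : 'I_n := Ordinal (leq_trans lti (leq_subr _ _)).
have takeS : take i.+1 e = rcons (take i e) (nth j0 e i).
  by rewrite (take_nth j0) ?sz_e.
have sA : A i \subset A i.+1.
  by apply/setUS/subsetP => j; rewrite !inE takeS mem_rcons inE orbC => ->.
split=> [x|sub].
  rewrite -[x]reprK => /(etrans (esym (K i _)))/eqP.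
  move: (repr x) => p kp; apply/(etrans (K i.+1 _))/eqP.
  by rewrite -[LHS](kill_comp p sA) -(rmorph0 (kill (A i.+1))) -kp.
have XP B j : (kill B 'X_j == 0) = (j \in B).
  have tU : touches B U_(j)%MM = (j \in B).
    apply/existsP/idP => [[l /andP[Bl]]|Bj]; last by exists j; rewrite Bj mnm1E eqxx.
    by rewrite mnm1E lt0b => /eqP ->.
  by rewrite killX tU; case: ifP => _; rewrite ?eqxx // -msize_poly_eq0 msizeX.
pose j := nth j0 e i.
have eU : uniq (take i.+1 e) by rewrite take_uniq ?enum_uniq.
have : j \in A i.
  rewrite -XP -K; apply: sub; apply/(etrans (K i.+1 _)).
  by rewrite XP !inE takeS mem_rcons mem_head orbT.
have : j \in e by rewrite mem_nth ?sz_e.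
rewrite mem_enum !inE => /negPf ->/=.
by move: eU; rewrite takeS rcons_uniq => /andP[/negPf ->].
Qed.

End VariableKilling.

(** * Powers of the maximal ideal *)

Section PowersOfMaximalIdeal.
Variables (k : fieldType) (n : nat).
Implicit Types (m w : 'X_{1..n}) (p : {mpoly k[n]}).

Lemma mem_ideal_gen (R : comNzRingType) (G : R -> Prop) x :
  G x -> x \in ideal_gen G.
Proof.
move=> Gx; apply/asboolP; exists [:: (1, x)]; split=> [y|].
  by rewrite inE => /eqP ->.
by rewrite big_seq1 mul1r.
Qed.

Lemma ideal_gen_sub (R : comNzRingType) (G G' : R -> Prop) :
  (forall x, G x -> G' x) -> {subset ideal_gen G <= ideal_gen G'}.
Proof.
move=> GG' x /asboolP[s [sG ->]]; apply/asboolP; exists s; split=> // y /sG.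
exact: GG'.
Qed.

(** Vanishing to order at least [d] at the origin, which describes the [d]-th power of the maximal
    ideal through coefficients. *)
Definition mdeg_geq (d : nat) p := forall m, (mdeg m < d)%N -> p@_m = 0.

Lemma mdeg_geqM a b p r : mdeg_geq a p -> mdeg_geq b r -> mdeg_geq (a + b) (p * r).
Proof.
move=> pa rb m ltm; rewrite mcoeffM big1 // => -[m1 m2] /= /eqP mE.
have [lt1|le1] := ltnP (mdeg m1) a; first by rewrite pa ?mul0r.
rewrite rb ?mulr0 //; by have := congr1 mdeg mE; rewrite mdegD; lia.
Qed.

Lemma mdeg_geq_gen (G : {mpoly k[n]} -> Prop) d :
  (forall p, G p -> mdeg_geq d p) -> {in ideal_gen G, forall p, mdeg_geq d p}.
Proof.
move=> Gd p /asboolP[s [sG ->]] m ltm; rewrite raddf_sum big_seq big1 // => x xs.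
by apply: (@mdeg_geqM 0 d) ltm => //; apply/Gd/sG.
Qed.

Lemma ideal_pow_mdeg_geq d : {in ideal_pow (max_ideal n k) d, forall p, mdeg_geq d p}.
Proof.
apply: mdeg_geq_gen => _ [[s /= size_s] sM ->]; have {}sM : {subset s <= _} := sM.
move/eqP: size_s => <-; elim: s sM => [//|x s IHs] sM.
rewrite big_cons /= -add1n; apply: mdeg_geqM; last first.
  by apply: IHs => z zs; apply: sM; rewrite inE zs orbT.
apply: mdeg_geq_gen (sM x (mem_head _ _)) => _ [i ->] m.
by rewrite ltnS leqn0 mdeg_eq0 => /eqP ->; rewrite mcoeffX mnm1_eq0.
Qed.

Lemma mnm_factor d m : (d <= mdeg m)%N -> exists2 w, mdeg w = d & (w <= m)%MM.
Proof.
elim: d => [_|d IHd ltd].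
  by exists 0%MM; [rewrite mdeg0 | apply/mnm_lepP => i; rewrite mnm0E].
have [w wd lew] := IHd (ltnW ltd).
have : (m - w != 0)%MM.
  by apply: contraTneq ltd => m0; rewrite -(submK lew) m0 add0m wd ltnn.
rewrite -mdeg_eq0 mdegE sum_nat_eq0 => /forallPn[i]; rewrite mnmBE /= => mi.
exists (w + U_(i))%MM; first by rewrite mdegD mdeg1 wd addn1.
apply/mnm_lepP => j; rewrite mnmDE mnm1E; move/mnm_lepP/(_ j): lew.
by case: eqVneq => [<-|_]; lia.
Qed.

Lemma mpolyX_prod_vars d w : mdeg w = d ->
  exists2 s : d.-tuple {mpoly k[n]}, {subset s <= max_ideal n k} &
    'X_[w] = \prod_(x <- s) x.
Proof.
elim: d w => [|d IHd] w wd.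
  exists [tuple] => //; rewrite big_nil.
  by move/eqP: wd; rewrite mdeg_eq0 => /eqP ->; rewrite mpolyX0.
have [|w' w'd le_w'w] := @mnm_factor d w; first by rewrite wd.
have : mdeg (w - w')%MM == 1%N.
  by rewrite -(eqn_add2r (mdeg w')) -mdegD submK // wd w'd add1n.
case/mdeg1P => i /eqP wi; have [s sM sE] := IHd w' w'd.
exists [tuple of 'X_i :: s].
  move=> x; rewrite inE => /predU1P[->|/sM//].
  by apply: mem_ideal_gen; exists i.
by rewrite big_cons -sE -mpolyXD -wi submK.
Qed.

(** Every monomial of degree at least [d] is a multiple of one of degree exactly [d]. The
    contrapositive is how the hypothesis [I <> m^d] enters. *)
Lemma lexseg_ideal_full (d : nat) (u v : 'X_{1..n}) : (0 < d)%N ->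
  (forall w, mdeg w = d -> w \in lexseg d u v) ->
  lexseg_ideal k d u v =i ideal_pow (max_ideal n k) d.
Proof.
move=> d0 full p; apply/idP/idP.
  apply: ideal_gen_sub => _ [w /andP[/eqP wd _] ->]; exact: mpolyX_prod_vars.
move/ideal_pow_mdeg_geq => pd; pose I := lexseg_idealr k u v d0.
suff : p \in I by [].
rewrite (mpolyE p) rpred_sum // => m _.
have [/pd ->|/mnm_factor[w wd lew]] := ltnP (mdeg m) d.
  by rewrite scale0r idealr0.
rewrite -(submK lew) -mul_mpolyC mpolyXD mulrA idealMr //.
by apply: mem_ideal_gen; exists w => //; apply: full.
Qed.

End PowersOfMaximalIdeal.

(** * Lexsegments *)

Section Lex.
Variable n : nat.
Implicit Types (m w : 'X_{1..n}).

(** Stated for the negation because a strict inequality has a witness, the first exponent that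
    differs. *)
Lemma lex_leNP (m1 m2 : 'X_{1..n}) :
  reflect (exists2 i : 'I_n, (m2 i < m1 i)%N &
             forall j : 'I_n, (j < i)%N -> m2 j = m1 j)
    (~~ lex_le m1 m2).
Proof.
rewrite /lex_le -Order.TotalTheory.ltNge.
have lexP := @ltxi_tuplePlt Order.NatOrder.nat_display
  (Order.seqlexi_display Order.NatOrder.nat_display) n nat m2 m1.
apply: (iffP lexP) => -[i].
  by exists i.
by exists i.
Qed.

(** Hence a lexicographic comparison in a fixed degree is never decided at the last variable. *)
Lemma mdeg_eq_all_but m1 m2 (i : 'I_n) :
  mdeg m1 = mdeg m2 -> (forall j, j != i -> m1 j = m2 j) -> m1 i = m2 i.
Proof.
rewrite !mdegE (bigD1 i)//= [RHS](bigD1 i)//= => eqd eqm.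
by apply/eqP; move/eqP: eqd; rewrite (eq_bigr _ eqm) eqn_add2r.
Qed.

Lemma leq_mdeg m i : (m i <= mdeg m)%N.
Proof. by rewrite mdegE (bigD1 i)//= leq_addr. Qed.

Lemma mdeg_concentrated m i j : m i = mdeg m -> j != i -> m j = 0%N.
Proof.
by move=> mi ji; move: mi; rewrite mdegE (bigD1 i)//= (bigD1 j)//=; lia.
Qed.
End Lex.

(** * Dimension from a least cover *)

Section Covers.
Variables (k : fieldType) (n d : nat) (u v : 'X_{1..n}) (d0 : (0 < d)%N).
Local Notation L := (lexseg d u v).

(** For the upper bound, the variables whose classes lie in [P 0] form a cover, since a prime
    containing a monomial contains one of its variables. *)
Lemma lexseg_krull_dim (C : {set 'I_n}) :
  {in L, forall w, touches C w} ->
  (forall T : {set 'I_n}, {in L, forall w, touches T w} -> (#|C| <= #|T|)%N) ->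
  has_krull_dim {ideal_quot (lexseg_idealr k u v d0)} (n - #|C|).
Proof.
move=> tC minC; split=> [|l P chP]; first exact: lexseg_prime_chain.
pose I := lexseg_idealr k u v d0.
pose g : {rmorphism {mpoly k[n]} -> {ideal_quot I}} := \pi_({ideal_quot I})%qT.
pose T := [set j | g 'X_j \in P 0%N].
have tT : {in L, forall w, touches T w}.
  move=> w Lw.
  have : g 'X_[w] \in P 0%N.
    have -> : g 'X_[w] = 0; last exact: idealr0.
    rewrite -(rmorph0 g); apply/eqP; rewrite -Quotient.idealrBE subr0.
    by apply: mem_ideal_gen; exists w.
  rewrite mpolyXE_id rmorph_prod => /prime_idealr_prod[j].
  rewrite rmorphXn => Pj; apply/existsP; exists j; rewrite inE (prime_idealrX Pj).
  by rewrite lt0n; apply: contraL Pj => /eqP ->; rewrite expr0 idealr1.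
apply: leq_trans (leq_sub2l n (minC T tT)).
apply: (@prime_chain_leq k n _ g T l P) chP => [x|j]; last by rewrite inE.
by exists (repr x); rewrite /g/= reprK.
Qed.

End Covers.

Lemma card_ord_lt n q : (q <= n)%N -> #|[set j : 'I_n | (j < q)%N]| = q.
Proof.
move=> leqn; rewrite -sum1_card (eq_bigl (fun j : 'I_n => j < q)%N).
  by rewrite (big_ord_narrow leqn) sum1_card card_ord.
by move=> j; rewrite inE.
Qed.

Theorem proposition2p3p1 (k : fieldType) (n d q : nat) (u v : 'X_{1..n})
    (hd : (2 <= d)%N) (hq : (1 <= q <= n)%N)
    (hu : mdeg u = d) (hv : mdeg v = d)
    (* a_1 > 0, b_1 = ... = b_(q-1) = 0 and b_q > 0, where the exponent of x_j
       is found at the ordinal of value j - 1 *)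
    (hu1 : forall i : 'I_n, i.+1 = 1%N -> (0 < u i)%N)
    (hvlt : forall i : 'I_n, (i.+1 < q)%N -> v i = 0%N)
    (hvq : forall i : 'I_n, i.+1 = q -> (0 < v i)%N)
    (huv : lex_le v u)
    (hI : ~ (lexseg_ideal k d u v =i ideal_pow (max_ideal n k) d)) :
  has_krull_dim {ideal_quot (lexseg_idealr k u v (ltnW hd))}
    (if (q < n)%N then (n - q)%N else 1%N).
Proof.
have [q0 leqn] := andP hq; have n0 := leq_trans q0 leqn.
pose o : 'I_n := Ordinal n0.
have u0 : (0 < u o)%N by exact: hu1.
have supp_v (i : 'I_n) : (0 < v i)%N -> (q <= i.+1)%N.
  by rewrite [(q <= _)%N]leqNgt; apply: contraL => /hvlt ->.
have ltqn1 : (q.-1 < n)%N by rewrite prednK.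
pose iq : 'I_n := Ordinal ltqn1.
have vq0 : (0 < v iq)%N by apply: hvq; rewrite /= prednK.
pose A := [set j : 'I_n | (j < q)%N].
have cardA : #|A| = q by exact: card_ord_lt.
have oA : o \in A by rewrite inE.
have cardAo : #|A :\ o| = q.-1 by have := cardsD1 o A; rewrite oA cardA => ->.
(* For [1 < j <= q], [x_j^d] is below [u], which involves [x_1], and at least [v], which involves no
   variable before [x_q]. *)
have powL j : j \in A :\ o -> (U_(j) *+ d)%MM \in lexseg d u v.
  rewrite !inE => /andP[jo ltjq]; rewrite mdegMn mdeg1 mul1n eqxx /=.
  apply/andP; split; apply/negPn/lex_leNP => -[i]; rewrite mulmnE mnm1E.
    case: eqVneq => [<-|ji]; first by rewrite mul1n ltnNge -hv leq_mdeg.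
    rewrite mul0n => vi eqv; have ltji : (j < i)%N.
      by have := supp_v i vi; move: ji; rewrite -val_eqE /=; lia.
    have := eqv j ltji; rewrite mulmnE mnm1E eqxx mul1n -hv => /esym vj.
    by rewrite (mdeg_concentrated vj) // eq_sym in vi.
  case: eqVneq => [<- _ eqv|_]; last by rewrite mul0n.
  have := eqv o; rewrite mulmnE mnm1E (negPf jo) mul0n lt0n => /(_ _)/eqP.
  by rewrite (gtn_eqF u0) => /(_ jo).
have coverAo (T : {set 'I_n}) :
    {in lexseg d u v, forall w, touches T w} -> A :\ o \subset T.
  move=> tT; apply/subsetP => j /powL/tT/existsP[i /andP[Ti]].
  by rewrite mulmnE mnm1E; case: eqVneq => [->|] //.
case: ltnP => [ltqn|leqnq].
  rewrite -cardA; apply: lexseg_krull_dim => [w /and3P[/eqP wd vw wu]|T tT].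
    (* A monomial free of [x_1, ..., x_q] first differs from [v] at [x_q], so it is smaller than
       [v]. *)
    apply: contraTT vw => nw; apply/lex_leNP.
    have wA (j : 'I_n) : (j < q)%N -> w j = 0%N.
      move=> jq; apply/eqP; rewrite -leqn0 leqNgt; apply: contra nw => wj.
      by apply/existsP; exists j; rewrite inE jq.
    exists iq => [|j ltj]; first by rewrite wA //= prednK.
    by rewrite wA ?hvlt //; move: ltj => /=; lia.
  suff [i Ti nAi] : exists2 i, i \in T & i \notin A :\ o.
    (* The summand [1] becomes the truth value of [i \notin A :\ o], the form in which [cardsU1]
       counts. *)
    rewrite cardA -(prednK q0) -cardAo -add1n -[1%N]/(nat_of_bool true).
    rewrite -nAi -cardsU1 subset_leq_card // subUset sub1set Ti.
    exact: coverAo.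
  (* For [q = 1] the set [A :\ o] is empty, so any variable of [u] in [T] will do. *)
  have [q1|q1] := leqP q 1.
    have /tT/existsP[i /andP[Ti _]] : u \in lexseg d u v.
      rewrite inE hu eqxx huv /=; apply/negPn/lex_leNP => -[i].
      by rewrite ltnn.
    by exists i => //; rewrite !inE -val_eqE /=; lia.
  have ltn1 : (n.-1 < n)%N by rewrite prednK.
  pose l : 'I_n := Ordinal ltn1.
  have lo : l != o by rewrite -val_eqE /=; lia.
  (* The least monomial of degree [d] divisible by [x_1], hence at most [u]; it exceeds [v] because
     [q >= 2]. As [q < n], neither of its variables is in [A :\ o]. *)
  pose w := (U_(o) + U_(l) *+ d.-1)%MM.
  have wE j : w j = ((j == o) + (j == l) * d.-1)%N.
    by rewrite mnmDE mulmnE !mnm1E ![_ == j]eq_sym.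
  have wd : mdeg w = d by rewrite mdegD mdegMn !mdeg1 mul1n; lia.
  have /tT/existsP[i /andP[Ti wi]] : w \in lexseg d u v.
    rewrite inE wd eqxx /=; apply/andP; split; apply/negPn/lex_leNP => -[i lti eqi].
      have io : (0 < i)%N by have := supp_v i (leq_ltn_trans (leq0n _) lti); lia.
      have := eqi o io; rewrite wE eqxx hvlt //=; lia.
    have [io|io] := eqVneq i o.
      by move: lti; rewrite io wE eqxx eq_sym (negPf lo); lia.
    have il : i = l.
      by move: lti; rewrite wE (negPf io); case: eqVneq => //; rewrite mul0n.
    have := @mdeg_eq_all_but n w u l (etrans wd (esym hu)).
    rewrite -il => eq_l; move: lti; rewrite eq_l ?ltnn // => j ji.
    by rewrite eqi // il /=; move: ji (ltn_ord j); rewrite il -val_eqE /=; lia.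
  exists i => //; move: wi; rewrite wE !inE -!val_eqE /=; lia.
have qn : q = n by apply/eqP; rewrite eqn_leq leqn.
have dimE : (n - #|A :\ o|)%N = 1%N by rewrite cardAo; lia.
rewrite -[X in has_krull_dim _ X]dimE.
apply: lexseg_krull_dim => [w /and3P[/eqP wd vw wu]|T /coverAo]; last first.
  exact: subset_leq_card.
(* A generator [w] avoiding [x_2, ..., x_n] is [x_1^d], which forces [u = x_1^d]; since [q = n]
   gives [v = x_n^d], the segment contains every monomial of degree [d]. *)
apply: contra_notT hI => nw; apply: lexseg_ideal_full => [|z zd]; first exact: ltnW.
have w0 (j : 'I_n) : j != o -> w j = 0%N.
  move=> jo; apply/eqP; rewrite -leqn0 leqNgt; apply: contra nw => wj.
  by apply/existsP; exists j; rewrite !inE jo qn ltn_ord.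
have wo : w o = d.
  by rewrite -wd mdegE (bigD1 o)//= big1 ?addn0.
have uo : u o = mdeg u.
  apply/eqP; rewrite eqn_leq leq_mdeg hu -wo leqNgt.
  by apply: contraL wu => ltu; apply/lex_leNP; exists o.
rewrite inE zd eqxx /=; apply/andP; split; apply/negPn/lex_leNP => -[i lti eqi].
  (* As [v] is a power of [x_n], the comparison could fail only at the last exponent, which the
     degree determines. *)
  have iE : n = i.+1 by have := supp_v i (leq_ltn_trans (leq0n _) lti); have := ltn_ord i; lia.
  move: lti; rewrite (@mdeg_eq_all_but n z v i) ?ltnn ?zd ?hv // => j ji.
  by apply: eqi; move: ji (ltn_ord j); rewrite -val_eqE /=; lia.
have [io|io] := eqVneq i o.
  by move: lti; rewrite io uo hu -zd ltnNge leq_mdeg.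
have oi : (o < i)%N by rewrite lt0n; move: io; rewrite -val_eqE.
have zo : z o = mdeg z by rewrite -eqi // uo hu zd.
by move: lti; rewrite (mdeg_concentrated zo).
Qed.
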